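(* Let $n \ge 1$ be an integer and let $m_0, m_1, \dots, m_n$ be positive integers. Define $$\bar{A} = \sum_{k=0}^{n} \Big(\prod_{j=k+1}^{n} m_j\Big) m_k^2 = m_n m_{n-1}\cdots m_1 (m_0)^2 + m_n m_{n-1}\cdots m_2 (m_1)^2 + \dots + m_n (m_{n-1})^2 + (m_n)^2$$ and $$\bar{B} = (m_0 m_1 \cdots m_n)^2 .$$ If $m_i \ge 2$ for all $i \in \{1, 2, \dots, n\}$ and $m_0 = m_1 = \dots = m_n$, then $\bar{A} < \bar{B}$.
   Context: Here $n+1$ is the number of input dimensions of a dataset and $m_k$ ($k = 0, 1, \dots, n$) is the number of samples in the $k$-th dimension. The quantity $\bar{A}$ denotes the computational cost of the Deep Kernel Recursive Least-Squares (D-KRLS) algorithm and $\bar{B}$ denotes the computational cost of the Kernel Recursive Least-Squares (KRLS) algorithm; for the claim these are simply the explicit expressions given. An empty product equals $1$. *)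

(* Defs.v *)
From mathcomp Require Import all_boot.

Set Implicit Arguments.
Unset Strict Implicit.
Unset Printing Implicit Defensive.

(* The sample sizes m_0, ..., m_n are a family indexed by 'I_n.+1; the inner
   product, over k < j <= n, is the empty product 1 when k = n. *)
Definition dkrls_cost (n : nat) (m : 'I_n.+1 -> nat) : nat :=
  \sum_(k < n.+1) (\prod_(j < n.+1 | k < j) m j) * m k ^ 2.

Definition krls_cost (n : nat) (m : 'I_n.+1 -> nat) : nat :=
  (\prod_(k < n.+1) m k) ^ 2.

(* Main.v *)
(** When all m_k equal c >= 2, the cost A is c^2 (1 + c + ... + c^n), a
    geometric sum smaller than c^2 c^(n+1), and n + 3 <= 2 (n + 1). *)
Require Import Defs.
From mathcomp Require Import all_boot.

(** Let c >= 2 be the common value. In base c, 1 + c + ... + c^n is written with n + 1 digits 1, so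
    it is below c^(n+1) ([sum_expn_lt]). Hence A < c^(n+3) <= c^(2n+2) = B, the exponents comparing
    because n >= 1. *)

Lemma sum_expn_lt (c n : nat) : 1 < c -> \sum_(i < n) c ^ i < c ^ n.
Proof.
move=> c_gt1; have c_gt0 := ltnW c_gt1.
(* The bound becomes sum <= c^n - 1 = (c - 1) * sum, where c - 1 > 0. *)
rewrite -[c ^ n]prednK ?expn_gt0 ?c_gt0 // ltnS predn_exp.
by rewrite leq_pmull // -subn1 subn_gt0.
Qed.

Lemma prod_ord_gt_const (c n k : nat) :
  \prod_(j < n | k < j) c = c ^ (n - k.+1).
Proof. by rewrite -(big_geq_mkord _ _ xpredT (fun=> c)) prod_nat_const_nat. Qed.

(** Under the reversal k = n - i, exactly i factors follow the k-th, so the inner product is c^i. *)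
Lemma dkrls_cost_const (c n : nat) (m : 'I_n.+1 -> nat) :
  (forall i, m i = c) -> dkrls_cost m = (\sum_(i < n.+1) c ^ i) * c ^ 2.
Proof.
move=> mE; rewrite /dkrls_cost big_distrl /= (reindex_inj rev_ord_inj) /=.
apply: eq_bigr => i _; under eq_bigr do rewrite mE.
by rewrite prod_ord_gt_const mE subSS subSS subKn // -ltnS.
Qed.

Lemma krls_cost_const (c n : nat) (m : 'I_n.+1 -> nat) :
  (forall i, m i = c) -> krls_cost m = c ^ (n.+1 * 2).
Proof.
move=> mE; rewrite /krls_cost; under eq_bigr do rewrite mE.
by rewrite prod_nat_const card_ord expnM.
Qed.

Theorem proposition1 (n : nat) (m : 'I_n.+1 -> nat)
    (n_ge1 : 1 <= n)
    (m_pos : forall i : 'I_n.+1, 0 < m i)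
    (m_ge2 : forall i : 'I_n.+1, 1 <= i -> 2 <= m i)
    (m_eq : forall i j : 'I_n.+1, m i = m j) :
  dkrls_cost m < krls_cost m.
Proof.
(* The last index is n >= 1, so [m_ge2] covers it, unlike index 0. *)
have c_gt1 : 1 < m ord_max by apply: m_ge2.
have mE i : m i = m ord_max by apply: m_eq.
rewrite (dkrls_cost_const _ _ _ mE) (krls_cost_const _ _ _ mE).
apply: (@leq_trans (m ord_max ^ n.+1 * m ord_max ^ 2)).
  by rewrite ltn_pmul2r ?sum_expn_lt // expn_gt0 m_pos.
by rewrite -expnD leq_exp2l // muln2 -addnn leq_add2l.
Qed.
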